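(* Let $G=(V,E)$ be a digraph admitting an oriented near $\alpha$-valuation $p$, and let $l$ be a positive integer. Then there exists an $(|E|l^2+1,\,|V|,\,l,\,1;\,G)$-EDF in $\mathbb{Z}_{|E|l^2+1}$.
   Context: Digraphs are oriented graphs (no loops, at most one of $(u,v),(v,u)$ is an arc). Identify $\mathbb{Z}_{n+1}$ with $\{0,1,\ldots,n\}$, ordered $0<1<\cdots<n$. For a digraph $G$ with $n$ arcs, an oriented $\beta$-valuation is an injective $b:V(G)\to\{0,\ldots,n\}$ such that the multiset $\{b(v)-b(u) \bmod (n+1) : (u,v)\in\overrightarrow{E}(G)\}$ equals $\mathbb{Z}_{n+1}\setminus\{0\}$. An oriented near $\alpha$-valuation is an oriented $\beta$-valuation $b$ for which there is a partition $V(G)=V_{small}\cup V_{large}$ such that each $v\in V_{small}$ has $b(v)<b(u)$ for all vertices $u$ adjacent to $v$ in the underlying undirected graph, and each $v\in V_{large}$ has $b(v)>b(u)$ for all such $u$. $\Delta(A,B)$ denotes the multiset $\{a-b:a\in A,b\in B\}$. For a group $\Gamma$ of order $n$ and digraph $H$ with $m$ vertices, a family $(A_v)_{v\in V(H)}$ of pairwise disjoint $l$-subsets of $\Gamma$ is an $(n,m,l,\lambda;H)$-EDF if $\bigcup_{(u,v)\in\overrightarrow{E}(H)}\Delta(A_v,A_u)=\lambda(\Gamma\setminus\{0\})$ as multisets.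
   Formalization: The digraph G is assumed to have at least one arc: for one vertex and no arcs the claim fails when l ≥ 2, since the trivial group has no l-subset; only the empty digraph and the single arcless vertex are excluded. *)

(* Defs.v *)
From mathcomp Require Import all_boot all_order all_algebra.
Set Implicit Arguments.
Unset Strict Implicit.
Unset Printing Implicit Defensive.
Import GRing.Theory.
Local Open Scope ring_scope.

Record digraph : Type := Digraph {
  vertex :> finType;
  arc : rel vertex;
  arc_irrefl : irreflexive arc;
  arc_asym : forall u v : vertex, arc u v -> ~~ arc v u
}.

Definition arcs (G : digraph) : {set G * G} := [set a | arc a.1 a.2].

Definition adjacent (G : digraph) (u v : G) : bool := arc u v || arc v u.

(* Multisets are sequences up to perm_eq. *)

Definition nonzeros (Gamma : finZmodType) : seq Gamma :=
  [seq x <- enum Gamma | x != 0].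

Definition Delta (Gamma : finZmodType) (A B : {set Gamma}) : seq Gamma :=
  [seq a - b | a <- enum A, b <- enum B].

(* 'I_n.+1 carries the additive group structure of the integers mod n+1, for
   every n, and coerces to nat: subtraction below is modulo #|arcs G|.+1, while
   in the near alpha condition the order is that of 0 < 1 < ... < #|arcs G|. *)
Definition oriented_beta_valuation (G : digraph)
    (b : G -> 'I_(#|arcs G|).+1) : Prop :=
  injective b /\
  perm_eq [seq b a.2 - b a.1 | a <- enum (arcs G)]
          (nonzeros 'I_(#|arcs G|).+1).

(* Either part may be empty. *)
Definition oriented_near_alpha_valuation (G : digraph)
    (b : G -> 'I_(#|arcs G|).+1) : Prop :=
  oriented_beta_valuation b /\
  exists Vsmall Vlarge : {set G},
    [/\ Vsmall :|: Vlarge = [set: G],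
        [disjoint Vsmall & Vlarge],
        forall v u : G, v \in Vsmall -> adjacent v u -> (b v < b u)%N
      & forall v u : G, v \in Vlarge -> adjacent v u -> (b u < b v)%N].

Definition is_EDF (n m l lambda : nat) (H : digraph) (Gamma : finZmodType)
    (A : H -> {set Gamma}) : Prop :=
  [/\ #|Gamma| = n,
      #|H| = m,
      forall v : H, #|A v| = l,
      forall u v : H, u != v -> [disjoint A u & A v]
    & perm_eq (flatten [seq Delta (A a.2) (A a.1) | a <- enum (arcs H)])
              (flatten (nseq lambda (nonzeros Gamma)))].

(* Main.v *)
(** Inflate the label [p v] to the [l] integers [l^2 * p v + i] (if [v] is small)
    or [l^2 * p v - i * l] (if [v] is large), for [0 <= i < l].  Every arc joins a
    small vertex to a large one, so the differences along an arc of label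
    difference [d] modulo [#|arcs G|.+1] fill the block
    [l^2 * (d - 1) < x <= l^2 * d]: each [k < l^2] is [j * l + i] for unique
    [i, j < l].  These blocks cover all nonzero residues, and counting shows that
    each residue is hit exactly once. *)

Require Import Defs.
From mathcomp Require Import all_boot all_order all_algebra.
From mathcomp Require Import zify.
Set Implicit Arguments.
Unset Strict Implicit.
Unset Printing Implicit Defensive.

Definition inflate (l : nat) (small : bool) (q i : nat) : nat :=
  if small then l ^ 2 * q + i else l ^ 2 * q - i * l.

Lemma inflate_lt l small q i : i < l -> inflate l small q i < l ^ 2 * q + l.
Proof. by rewrite /inflate; case: small; lia. Qed.

(** The worst case is a large label [q.+1] with [i = l - 1], where [l ^ 2 * q.+1 - (l - 1) * l = l ^
    2 * q + l]. With [inflate_lt], the values of a label [q > 0] thus lie in the window from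
    [l ^ 2 * (q - 1) + l] up to [l ^ 2 * q + l] (excluded), and windows of distinct labels are
    disjoint, whether small or large. *)
Lemma inflate_ge l small q q' i : i < l -> q < q' ->
  l ^ 2 * q + l <= inflate l small q' i.
Proof.
move=> lt_il lt_q; have := leq_mul (leqnn (l ^ 2)) lt_q; rewrite mulnS.
have := leq_mul lt_il (leqnn l); rewrite mulSn mulnn.
have := leq_pmull l (leq_ltn_trans (leq0n i) lt_il); rewrite mulnn.
by rewrite /inflate; case: small; lia.
Qed.

Lemma inflate_inj l small q q' i i' small' :
  i < l -> i' < l -> inflate l small q i = inflate l small' q' i' -> q = q'.
Proof.
move=> lt_il lt_i'l eq_f; case: (ltngtP q q') => // lt_q.
  by have := inflate_lt small q lt_il; have := inflate_ge small' lt_i'l lt_q; lia.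
by have := inflate_lt small' q' lt_i'l; have := inflate_ge small lt_il lt_q; lia.
Qed.

(** A large label must be positive: at [q = 0] the truncated subtraction would send every [i] to
    [0]. *)
Lemma inflate_injr l (small : bool) q i i' : (~~ small -> 0 < q) ->
  i < l -> i' < l -> inflate l small q i = inflate l small q i' -> i = i'.
Proof.
rewrite /inflate; case: small => [_ _ _|/(_ isT) q_gt0 lt_il lt_i'l].
  exact: addnI.
have l_gt0 := leq_ltn_trans (leq0n i) lt_il.
have bound k : k < l -> k * l <= l ^ 2 * q.
  by move=> lt_kl; rewrite -mulnn -mulnA (leq_mul (ltnW lt_kl)) ?leq_pmulr.
move=> eq_f; apply/eqP; rewrite -(eqn_pmul2r l_gt0); apply/eqP.
by have := bound _ lt_il; have := bound _ lt_i'l; lia.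
Qed.

Lemma inflate_le l (small : bool) n q i : (small -> q < n) -> i < l -> q <= n ->
  inflate l small q i <= n * l ^ 2.
Proof.
rewrite (mulnC n); case: small => [/(_ isT) lt_qn|_] lt_il le_qn.
  apply/ltnW/(leq_trans (inflate_lt _ _ lt_il)).
  have l_gt0 := leq_ltn_trans (leq0n i) lt_il.
  (* The comparison is with the large value of label [n] at index [0], which is [l ^ 2 * n]. *)
  exact: leq_trans (inflate_ge false l_gt0 lt_qn) (leq_subr _ _).
by rewrite (leq_trans (leq_subr _ _)) // leq_mul2l le_qn orbT.
Qed.

(** Euclidean division splits [k]: the large end loses [(k %/ l) * l] and the small end gains
    [k %% l], so the gap [l ^ 2 * d] shrinks by exactly [k]. *)
Lemma inflate_sub l q q' d k : k < l ^ 2 -> q' = q + d -> 0 < d ->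
  inflate l false q' (k %/ l) = inflate l true q (k %% l) + (l ^ 2 * d - k).
Proof.
move=> lt_k -> d_gt0; rewrite /inflate mulnDr.
have := divn_eq k l; have : l ^ 2 <= l ^ 2 * d by rewrite leq_pmulr.
lia.
Qed.

Lemma size_nonzeros_ord n : size (nonzeros 'I_n.+1) = n.
Proof.
have /eqP := count_predC (pred1 (0%R : 'I_n.+1)) (enum 'I_n.+1).
rewrite (count_uniq_mem _ (enum_uniq _)) mem_enum size_enum_ord.
by rewrite eqn_add2l size_filter => /eqP.
Qed.

Lemma ord_sub_eq n (x y z : 'I_n.+1) :
  (x + y = z \/ x + y = z + n.+1) -> (z - y)%R = x.
Proof.
move=> xyz; apply/eqP; rewrite GRing.subr_eq; apply/eqP/val_inj => /=.
by case: xyz => ->; rewrite ?modnDr modn_small.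
Qed.

Lemma ord_sub_val n (x y z : 'I_n.+1) :
  (z - y)%R = x -> x + y = z \/ x + y = z + n.+1.
Proof.
move=> <-; have /(congr1 val)/= := GRing.subrK y z.
set w := (z - y)%R; have := ltn_ord w; have := ltn_ord y.
case: (ltnP (w + y) n.+1) => [lt_wy|le_wy]; first by rewrite modn_small //; left.
move=> lt_y lt_w; rewrite -(subnK le_wy) modnDr modn_small; last by lia.
by move=> <-; right.
Qed.

Theorem theorem5p18 (G : digraph) (hE : (0 < #|arcs G|)%N)
    (p : G -> 'I_(#|arcs G|).+1) (hp : oriented_near_alpha_valuation p)
    (l : nat) (hl : (0 < l)%N) :
  exists A : G -> {set 'I_(#|arcs G| * l ^ 2).+1},
    is_EDF (#|arcs G| * l ^ 2).+1 #|G| l 1 A.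
Proof.
case: hp => [[p_inj p_perm] [Vs [Vl [VU Vdis smallP largeP]]]].
set n := #|arcs G| in hE p p_inj p_perm smallP largeP *.
have p_le v : p v <= n by rewrite -ltnS.
(* An isolated vertex may lie in either part: label [0] is made small and the
   maximal label large, so that no inflated label leaves [0, n * l^2]. *)
pose small v := (v \in Vs) && (p v < n) || (p v == 0 :> nat).
have small_lt v : small v -> p v < n by case/orP=> [/andP[]|/eqP->].
have large_gt v : ~~ small v -> 0 < p v by rewrite negb_or lt0n => /andP[].
have edgeP u v : adjacent u v -> p u < p v -> small u /\ small v = false.
  move=> uv lt_uv; have vu : adjacent v u by rewrite /adjacent orbC.
  have Vsl w : (w \in Vs) || (w \in Vl) by rewrite -in_setU VU inE.
  have u_s : u \in Vs.
    by case/orP: (Vsl u) => // /largeP/(_ uv); rewrite ltnNge (ltnW lt_uv).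
  have v_s : v \in Vs = false.
    by apply/negP => /smallP/(_ vu); rewrite ltnNge (ltnW lt_uv).
  rewrite /small u_s v_s (leq_trans lt_uv (p_le v)) /=; split=> //.
  by apply/eqP => v0; rewrite v0 in lt_uv.
pose f v i := inflate l (small v) (p v) i.
pose c v (i : 'I_l) : 'I_(n * l ^ 2).+1 := inord (f v i).
have cE v i : c v i = f v i :> nat.
  by rewrite inordK // ltnS; apply: inflate_le => //; apply: small_lt.
have mem_c v i (lt_il : i < l) : c v (Ordinal lt_il) \in [set c v i | i : 'I_l].
  exact: imset_f.
have cardA v : #|[set c v i | i : 'I_l]| = l.
  rewrite card_imset ?card_ord // => i j /(congr1 val); rewrite /= !cE => eq_f.
  exact/val_inj/(inflate_injr (large_gt v) (ltn_ord i) (ltn_ord j) eq_f).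
exists (fun v => [set c v i | i : 'I_l]); split=> //; first by rewrite card_ord.
  move=> u v neq_uv; apply/pred0P => x; apply/negP => /andP[/imsetP[i _ ->]].
  case/imsetP=> j _ /(congr1 val); rewrite /= !cE.
  move/(inflate_inj (ltn_ord i) (ltn_ord j))/val_inj/p_inj => eq_uv.
  by rewrite eq_uv eqxx in neq_uv.
rewrite /= cats0; set s := flatten _; set t := nonzeros _.
have t_uniq : uniq t by rewrite filter_uniq ?enum_uniq.
(* Each of the [n] arcs gives [l ^ 2] differences. Since [t] has no repetition, it then suffices
   that every nonzero residue occurs in [s]. *)
have size_s : size s <= size t.
  rewrite size_nonzeros_ord size_flatten /shape -map_comp sumnE big_map.
  rewrite (eq_bigr (fun=> l ^ 2)) => [|a _]; last first.
    by rewrite /= size_allpairs -!cardE !cardA mulnn.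
  by rewrite big_enum /= sum_nat_const.
have sub_ts : {subset t <= s}.
  move=> x; rewrite mem_filter => /andP[x_neq0 _].
  have x_gt0 : 0 < x by rewrite lt0n.
  have x_le : x <= n * l ^ 2 by rewrite -ltnS.
  have L_gt0 : 0 < l ^ 2 by rewrite expn_gt0 hl.
  (* The shift by one puts [x] in the block of label difference [q.+1], which is at most [n], so
     some arc realises it. *)
  pose q := x.-1 %/ l ^ 2; pose r := x.-1 %% l ^ 2.
  have xE : x = q * l ^ 2 + r + 1 :> nat by rewrite -divn_eq; lia.
  have lt_r : r < l ^ 2 by rewrite ltn_pmod.
  have lt_qn : q < n by rewrite ltn_divLR //; lia.
  have : (inord q.+1 : 'I_n.+1) \in nonzeros 'I_n.+1.
    rewrite mem_filter mem_enum andbT; apply/eqP => /(congr1 val) /=.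
    by rewrite inordK.
  rewrite -(perm_mem p_perm) => /mapP[[u v]]; rewrite mem_enum inE /= => arc_uv.
  move=> /esym/ord_sub_val; rewrite inordK // => sub_p.
  suff [i [j [lt_i lt_j eq_x]]] : exists i j, [/\ i < l, j < l &
      x + f u j = f v i \/ x + f u j = f v i + (n * l ^ 2).+1].
    apply/flattenP; exists (Delta [set c v i | i : 'I_l] [set c u i | i : 'I_l]).
      by apply/mapP; exists (u, v); rewrite ?mem_enum ?inE.
    apply/allpairsP; exists (c v (Ordinal lt_i), c u (Ordinal lt_j)).
    split; rewrite ?mem_enum ?mem_c //=.
    by apply/esym/ord_sub_eq; rewrite !cE.
  have lt_mod k : k %% l < l by rewrite ltn_mod.
  have lt_div k : k < l ^ 2 -> k %/ l < l by rewrite ltn_divLR // mulnn.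
  case: sub_p => sub_p.
    (* No wrap-around: [p v = p u + q.+1], and [x] is [l ^ 2 * q.+1 - k] for [k = l ^ 2 - 1 - r]. *)
    have [|u_small v_large] := edgeP u v _ ltac:(lia).
      by rewrite /adjacent arc_uv.
    pose k := (l ^ 2).-1 - r; have lt_k : k < l ^ 2 by rewrite /k; lia.
    exists (k %/ l), (k %% l); split; rewrite ?lt_div // /f u_small v_large.
    have xk : l ^ 2 * q.+1 - k = x.
      by rewrite mulnS /k mulnC; move: xE lt_r; clear; lia.
    left; rewrite (inflate_sub lt_k (_ : p v = p u + q.+1 :> nat)) // ?xk.
      exact: addnC.
    by rewrite addnC.
  (* Wrap-around: [p u = p v + (n - q)], so the roles of the ends are exchanged. The opposite
     difference [l ^ 2 * (n - q) - r] is the complement of [x] to the modulus, hence [r] itself is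
     the number divided by [l]. *)
  have pv_lt : p v < p u by have := p_le v; lia.
  have [|v_small u_large] := edgeP v u _ pv_lt.
    by rewrite /adjacent arc_uv orbT.
  exists (r %% l), (r %/ l); split; rewrite ?lt_div // /f v_small u_large.
  have xr : x + (l ^ 2 * (n - q) - r) = (n * l ^ 2).+1.
    have : l ^ 2 <= l ^ 2 * (n - q) by rewrite leq_pmulr // subn_gt0.
    have := leq_mul (ltnW lt_qn) (leqnn (l ^ 2)).
    by rewrite mulnBr !(mulnC (l ^ 2)); move: xE lt_r; clear; lia.
  right; rewrite (inflate_sub lt_r (_ : p u = p v + (n - q) :> nat)) ?subn_gt0 //.
    by rewrite addnCA xr.
  by move: sub_p lt_qn; clear; lia.
have [_ eq_ts] := uniq_min_size t_uniq sub_ts size_s.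
by rewrite perm_sym uniq_perm // (leq_size_uniq t_uniq).
Qed.
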